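(* (a) The major index $\mathrm{maj}$ is shuffle-compatible. (b) The linear map on $\mathcal{A}_{\mathrm{maj}}$ defined by $[\pi]_{\mathrm{maj}}\mapsto \frac{q^{\mathrm{maj}(\pi)}}{[|\pi|]_q!}x^{|\pi|}$ is a $\mathbb{Q}$-algebra isomorphism from $\mathcal{A}_{\mathrm{maj}}$ to the span of $\left\{\frac{q^j}{[n]_q!}x^n\right\}_{n\ge0,\ 0\le j\le\binom n2}$, which is a subalgebra of $\mathbb{Q}[[q]][x]$. (c) The $n$th homogeneous component of $\mathcal{A}_{\mathrm{maj}}$ has dimension $\binom n2+1$.
   Context: A permutation of length $n$ is a sequence of $n$ distinct positive integers; a permutation statistic is a function on permutations depending only on relative order. For disjoint permutations $\pi,\sigma$, $S(\pi,\sigma)$ is the set of shuffles (permutations of length $|\pi|+|\sigma|$ containing both as subsequences). A statistic $\mathrm{st}$ is shuffle-compatible if for disjoint $\pi,\sigma$ the multiset $\{\mathrm{st}(\tau):\tau\in S(\pi,\sigma)\}$ depends only on $\mathrm{st}(\pi),\mathrm{st}(\sigma),|\pi|,|\sigma|$. Permutations $\pi,\sigma$ are $\mathrm{st}$-equivalent if $\mathrm{st}(\pi)=\mathrm{st}(\sigma)$ and $|\pi|=|\sigma|$; $[\pi]_{\mathrm{st}}$ denotes the class. For shuffle-compatible $\mathrm{st}$, the shuffle algebra $\mathcal{A}_{\mathrm{st}}$ is the $\mathbb{Q}$-vector space with basis the $\mathrm{st}$-equivalence classes and multiplication $[\pi]_{\mathrm{st}}[\sigma]_{\mathrm{st}}=\sum_{\tau\in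 S(\pi,\sigma)}[\tau]_{\mathrm{st}}$ (for disjoint representatives), graded by length. The major index is $\mathrm{maj}(\pi)=\sum_{k:\pi_k>\pi_{k+1}}k$. $[n]_q!=\prod_{i=1}^n(1+q+\cdots+q^{i-1})$. *)

(* Defs.v *)
From HB Require Import structures.
From mathcomp Require Import all_boot all_order all_algebra generic_quotient.
From mathcomp Require Import finmap boolp classical_sets monalg.

Set Implicit Arguments.
Unset Strict Implicit.
Unset Printing Implicit Defensive.

Import GRing.Theory.
Local Open Scope ring_scope.

Record fps (R : Type) := FPS { fps_coef :> nat -> R }.

HB.instance Definition _ (R : Type) := gen_eqMixin (fps R).
HB.instance Definition _ (R : Type) := gen_choiceMixin (fps R).

Lemma fpsP (R : Type) (f g : fps R) : f =1 g -> f = g.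
Proof. by case: f g => [f] [g] /= /funext ->. Qed.

Section FpsRing.
Variable R : comNzRingType.
Implicit Types f g h : fps R.

Definition fps_zero : fps R := FPS (fun=> 0).
Definition fps_opp f := FPS (fun n => - f n).
Definition fps_add f g := FPS (fun n => f n + g n).
Definition fps_one : fps R := FPS (fun n => (n == 0)%:R).
Definition fps_mul f g := FPS (fun n => \sum_(i < n.+1) f i * g (n - i)%N).
Definition fps_scale (c : R) f := FPS (fun n => c * f n).

Fact fps_addA : associative fps_add.
Proof. by move=> f g h; apply: fpsP => n /=; rewrite addrA. Qed.
Fact fps_addC : commutative fps_add.
Proof. by move=> f g; apply: fpsP => n /=; rewrite addrC. Qed.
Fact fps_add0 : left_id fps_zero fps_add.
Proof. by move=> f; apply: fpsP => n /=; rewrite add0r. Qed.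
Fact fps_addN : left_inverse fps_zero fps_opp fps_add.
Proof. by move=> f; apply: fpsP => n /=; rewrite addNr. Qed.

HB.instance Definition _ :=
  GRing.isZmodule.Build (fps R) fps_addA fps_addC fps_add0 fps_addN.

Definition fps_trunc n f : {poly R} := \poly_(i < n) f i.

Lemma coef_fps_trunc n f i : (i < n)%N -> (fps_trunc n f)`_i = f i.
Proof. by move=> lt_in; rewrite coef_poly lt_in. Qed.

Lemma coef_fps_truncM n f g i : (i < n)%N ->
  (fps_trunc n f * fps_trunc n g)`_i = fps_mul f g i.
Proof.
move=> lt_in; rewrite coefM /=; apply: eq_bigr => j _.
rewrite !coef_fps_trunc //; first exact: leq_ltn_trans (leq_subr _ _) lt_in.
by apply: leq_ltn_trans lt_in; rewrite -ltnS.
Qed.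

Fact fps_mulC : commutative fps_mul.
Proof.
move=> f g; apply: fpsP => n.
by rewrite -!(@coef_fps_truncM n.+1) // mulrC.
Qed.

Fact fps_mulA : associative fps_mul.
Proof.
move=> f g h; apply: fpsP => n.
pose P := fps_trunc n.+1.
transitivity ((P f * (P g * P h))`_n); last first.
  rewrite mulrA coefM /=; apply: eq_bigr => i _.
  by rewrite coef_fps_truncM // coef_fps_trunc // ltnS leq_subr.
rewrite coefM /=; apply: eq_bigr => i _.
by rewrite coef_fps_truncM ?ltnS ?leq_subr // coef_fps_trunc.
Qed.

Fact fps_mul1 : left_id fps_one fps_mul.
Proof.
move=> f; apply: fpsP => n /=.
rewrite big_ord_recl /= mul1r subn0 big1 ?addr0 // => i _.
by rewrite mul0r.
Qed.

Fact fps_mulDl : left_distributive fps_mul fps_add.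
Proof.
move=> f g h; apply: fpsP => n /=; rewrite -big_split.
by apply: eq_bigr => i _; rewrite mulrDl.
Qed.

Fact fps_one_neq0 : fps_one != 0.
Proof.
apply/eqP => /(congr1 (fun f : fps R => f 0%N)) /eqP.
by rewrite /= oner_eq0.
Qed.

HB.instance Definition _ := GRing.Zmodule_isComNzRing.Build (fps R)
  fps_mulA fps_mulC fps_mul1 fps_mulDl fps_one_neq0.

Fact fps_scaleA a b f : fps_scale a (fps_scale b f) = fps_scale (a * b) f.
Proof. by apply: fpsP => n /=; rewrite mulrA. Qed.
Fact fps_scale1 : left_id 1 fps_scale.
Proof. by move=> f; apply: fpsP => n /=; rewrite mul1r. Qed.
Fact fps_scaleDr : right_distributive fps_scale +%R.
Proof. by move=> a f g; apply: fpsP => n /=; rewrite mulrDr. Qed.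
Fact fps_scaleDl f : {morph fps_scale^~ f : a b / a + b}.
Proof. by move=> a b; apply: fpsP => n /=; rewrite mulrDl. Qed.

HB.instance Definition _ := GRing.Zmodule_isLmodule.Build R (fps R)
  fps_scaleA fps_scale1 fps_scaleDr fps_scaleDl.

Fact fps_scaleAl (c : R) (f g : fps R) : c *: (f * g) = c *: f * g.
Proof.
apply: fpsP => n /=; rewrite mulr_sumr.
by apply: eq_bigr => i _; rewrite mulrA.
Qed.

HB.instance Definition _ := GRing.Lmodule_isLalgebra.Build R (fps R) fps_scaleAl.
HB.instance Definition _ := GRing.Lalgebra_isComAlgebra.Build R (fps R).

Definition fps_var : fps R := FPS (fun n => (n == 1)%:R).

Lemma fps_sumE (I : Type) (r : seq I) (P : pred I) (F : I -> fps R) n :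
  (\sum_(i <- r | P i) F i) n = \sum_(i <- r | P i) F i n.
Proof. exact: (big_morph (fun f : fps R => f n)). Qed.

Lemma fps_expr_small f k n : f 0%N = 0 -> (n < k)%N -> (f ^+ k) n = 0.
Proof.
move=> f0; elim: k n => // k IHk n lt_nk; rewrite exprS /=.
rewrite big1 // => -[[|i] lt_in] _ /=; first by rewrite f0 mul0r.
rewrite IHk ?mulr0 //; move: lt_in lt_nk; rewrite !ltnS => le_in le_nk.
by rewrite (leq_trans _ le_nk) // ltn_subrL (leq_trans _ le_in).
Qed.

End FpsRing.

Section FpsUnit.
Variable R : comUnitRingType.
Implicit Types f g : fps R.

Definition fps_unit : pred (fps R) := fun f => f 0%N \is a GRing.unit.

(* The geometric series of 1 - f / f_0, divided by f_0; the n-th coefficient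
   only involves the powers of exponent at most n. *)
Definition fps_inv f : fps R :=
  if fps_unit f then
    let g := 1 - (f 0%N)^-1 *: f in
    FPS (fun n => (f 0%N)^-1 * \sum_(k < n.+1) (g ^+ k) n)
  else f.

Fact fps_mulVr : {in fps_unit, left_inverse 1 fps_inv *%R}.
Proof.
move=> f Uf; have Uf' : f 0%N \is a GRing.unit by [].
have {}Uf : fps_unit f by [].
rewrite /fps_inv Uf; set a := f 0%N in Uf' *; set g := 1 - _.
have g0 : g 0%N = 0.
  by rewrite /g -[LHS]/(1 - a^-1 * a) mulVr ?subrr.
have -> : f = a *: (1 - g).
  by rewrite /g opprB addrC subrK scalerA mulrV ?scale1r.
apply: fpsP => n; pose G : fps R := \sum_(k < n.+1) g ^+ k.
transitivity ((a^-1 *: G * (a *: (1 - g))) n).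
  apply: eq_bigr => -[i lt_in] _ /=; congr (_ * _ * _).
  rewrite /G fps_sumE -!(big_mkord xpredT (fun k => (g ^+ k) i)).
  rewrite [RHS](@big_cat_nat _ _ _ i.+1) //= [X in _ = _ + X]big_nat_cond.
  rewrite [X in _ = _ + X]big1 ?addr0 // => k /andP[/andP[lt_ik _] _].
  exact: fps_expr_small.
rewrite -scalerAr -scalerAl scalerA mulrV // scale1r mulrC.
rewrite -opprB mulNr -subrX1 opprB -[LHS]/((1 : fps R) n - (g ^+ n.+1) n).
by rewrite fps_expr_small // subr0.
Qed.

Fact fps_unitP f g : g * f = 1 -> fps_unit f.
Proof.
move=> /(congr1 (fun h : fps R => h 0%N)) /=.
rewrite big_ord1 subn0 /= => gf1; apply/unitrP; exists (g 0%N).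
by rewrite [f _ * _]mulrC gf1.
Qed.

Fact fps_inv_out : {in [predC fps_unit], fps_inv =1 id}.
Proof.
by move=> f; rewrite inE /fps_inv => /negPf nUf; rewrite [fps_unit f]nUf.
Qed.

HB.instance Definition _ := GRing.ComNzRing_hasMulInverse.Build (fps R)
  fps_mulVr fps_unitP fps_inv_out.

End FpsUnit.

(* An alias, because {poly fps rat} canonically carries its structure of
   algebra over fps rat rather than over rat. *)
Definition qpsx := {poly fps rat}.

HB.instance Definition _ := GRing.ComNzRing.on qpsx.

Section QpsxAlgebra.
Implicit Types (c : rat) (p : qpsx).

Definition qpsx_scale c p : qpsx := (c%:A : fps rat) *: (p : {poly fps rat}).

Fact qpsx_scaleA a b p : qpsx_scale a (qpsx_scale b p) = qpsx_scale (a * b) p.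
Proof. by rewrite /qpsx_scale scalerA -scalerAl mul1r scalerA. Qed.
Fact qpsx_scale1 : left_id 1 qpsx_scale.
Proof. by move=> p; rewrite /qpsx_scale !scale1r. Qed.
Fact qpsx_scaleDr : right_distributive qpsx_scale +%R.
Proof. by move=> a p1 p2; rewrite /qpsx_scale scalerDr. Qed.
Fact qpsx_scaleDl p : {morph qpsx_scale^~ p : a b / a + b}.
Proof. by move=> a b; rewrite /qpsx_scale !scalerDl. Qed.

HB.instance Definition _ := GRing.Zmodule_isLmodule.Build rat qpsx
  qpsx_scaleA qpsx_scale1 qpsx_scaleDr qpsx_scaleDl.

Fact qpsx_scaleAl c (p1 p2 : qpsx) : c *: (p1 * p2) = c *: p1 * p2.
Proof. exact: (@scalerAl _ {poly fps rat}). Qed.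

HB.instance Definition _ :=
  GRing.Lmodule_isLalgebra.Build rat qpsx qpsx_scaleAl.
HB.instance Definition _ := GRing.Lalgebra_isComAlgebra.Build rat qpsx.

End QpsxAlgebra.

Local Notation q := (fps_var rat).

Definition qfact (n : nat) : fps rat :=
  \prod_(1 <= i < n.+1) \sum_(0 <= k < i) q ^+ k.

Definition qterm (n j : nat) : qpsx := (q ^+ j / qfact n)%:P * 'X^n.

Lemma qfact_unit n : qfact n \is a GRing.unit.
Proof.
rewrite /qfact big_seq; apply: (big_ind (fun f => f \is a GRing.unit)).
- exact: unitr1.
- by move=> f g; rewrite unitrM => -> ->.
- move=> [|i]; rewrite mem_index_iota // => _.
  suff: fps_unit (\sum_(0 <= k < i.+1) q ^+ k) by [].
  rewrite /fps_unit fps_sumE big_nat_recl // big_nat big1 ?addr0 //=.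
  by move=> k _; rewrite exprS /= big_ord1 /= mul0r.
Qed.

Definition lspan (F : nzRingType) (V : lmodType F) (B : set V) : set V :=
  [set v | exists (n : nat) (c : 'I_n -> F) (b : 'I_n -> V),
     (forall i, B (b i)) /\ v = \sum_i c i *: b i].

Definition has_dim (F : fieldType) (V : lmodType F) (S : set V) (n : nat) :=
  exists b : 'I_n -> V,
    (forall c : 'I_n -> F, \sum_i c i *: b i = 0 -> forall i, c i = 0) /\
    lspan (range b) = S.

Record permutation := Permutation {
  perm_seq :> seq nat;
  _ : uniq perm_seq && all (ltn 0) perm_seq }.

HB.instance Definition _ := [isSub for perm_seq].
HB.instance Definition _ := [Countable of permutation by <:].

Implicit Types pi sigma tau : permutation.

Lemma perm_uniq pi : uniq pi.
Proof. by case: pi => s /= /andP[]. Qed.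

Lemma perm_gt0 pi : all (ltn 0) pi.
Proof. by case: pi => s /= /andP[]. Qed.

Definition disjointp pi sigma := ~~ has [in perm_seq sigma] pi.

Definition shuffles pi sigma : seq permutation :=
  [seq tau : permutation <- pmap insub (permutations (pi ++ sigma))
     | subseq pi tau && subseq sigma tau].

Lemma disjointpC pi sigma : disjointp pi sigma = disjointp sigma pi.
Proof. by rewrite /disjointp has_sym. Qed.

Lemma shuffles_uniq pi sigma : uniq (shuffles pi sigma).
Proof.
by rewrite filter_uniq // (pmap_uniq (insubK _)) // permutations_uniq.
Qed.

Lemma mem_shuffles_perm pi sigma tau : tau \in shuffles pi sigma =
  [&& perm_eq tau (pi ++ sigma), subseq pi tau & subseq sigma tau].
Proof.
by rewrite mem_filter mem_pmap_sub mem_permutations andbC.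
Qed.

Lemma disjoint_cat_perm (s t u : seq nat) : uniq s -> uniq t ->
    ~~ has [in t] s -> subseq s u -> subseq t u ->
  size u = (size s + size t)%N -> perm_eq u (s ++ t).
Proof.
move=> Us Ut dst su tu sz; rewrite perm_sym.
have Ust : uniq (s ++ t) by rewrite cat_uniq Us Ut has_sym dst.
have sub : {subset s ++ t <= u}.
  by move=> x; rewrite mem_cat => /orP[]; apply: mem_subseq.
have [] := uniq_min_size Ust sub; first by rewrite size_cat sz.
move=> _ eq_mem; apply: uniq_perm => //.
by rewrite -(eq_uniq _ eq_mem) // size_cat sz.
Qed.

(* For disjoint pi and sigma, these are the permutations of length
   |pi| + |sigma| having both pi and sigma as subsequences. *)
Lemma mem_shuffles pi sigma tau : disjointp pi sigma ->
  tau \in shuffles pi sigma =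
  [&& size tau == (size pi + size sigma)%N, subseq pi tau & subseq sigma tau].
Proof.
move=> dps; rewrite mem_shuffles_perm; apply/and3P/and3P => -[].
  by move=> /perm_size -> -> ->; rewrite size_cat.
move=> /eqP sz st tt; split=> //.
by apply: disjoint_cat_perm => //; apply: perm_uniq.
Qed.

Definition same_order pi sigma : Prop :=
  size pi = size sigma /\
  forall i j, (i < size pi)%N -> (j < size pi)%N ->
    (nth 0%N pi i < nth 0%N pi j)%N = (nth 0%N sigma i < nth 0%N sigma j)%N.

Record statistic (T : eqType) := Statistic {
  stat_fun :> permutation -> T;
  stat_order : forall pi sigma,
    same_order pi sigma -> stat_fun pi = stat_fun sigma }.

Definition shuffle_compatible (T : eqType) (st : statistic T) : Prop :=
  forall pi pi' sigma sigma',
    disjointp pi sigma -> disjointp pi' sigma' ->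
    st pi = st pi' -> st sigma = st sigma' ->
    size pi = size pi' -> size sigma = size sigma' ->
  perm_eq [seq st tau | tau <- shuffles pi sigma]
          [seq st tau | tau <- shuffles pi' sigma'].

(* The pair pi_k > pi_{k+1}, with letters numbered from 1, is read at the
   0-based indices k.-1 and k. *)
Definition maj_fun pi : nat :=
  (\sum_(1 <= k < size pi | nth 0 pi k < nth 0 pi k.-1) k)%N.

Fact maj_order pi sigma : same_order pi sigma -> maj_fun pi = maj_fun sigma.
Proof.
move=> [sz lt_eq]; rewrite /maj_fun -sz [LHS]big_nat_cond [RHS]big_nat_cond.
apply: eq_bigl => -[|k] //=; case: ltnP => //= lt_k; rewrite lt_eq //.
exact: ltn_trans lt_k.
Qed.

Definition maj : statistic nat := Statistic maj_order.

Local Open Scope quotient_scope.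

Section StatClass.
Variables (T : eqType) (st : statistic T).

Definition st_equiv : rel permutation :=
  fun pi sigma => (st pi == st sigma) && (size pi == size sigma).

Fact st_equiv_is_equiv : equiv_class_of st_equiv.
Proof.
split=> [pi | pi sigma | sigma pi tau]; rewrite /st_equiv ?eqxx //.
  by rewrite eq_sym [size pi == _]eq_sym.
by move=> /andP[/eqP-> /eqP->].
Qed.

Canonical st_equiv_equiv := EquivRelPack st_equiv_is_equiv.

Definition st_class := {eq_quot st_equiv}.

HB.instance Definition _ : EqQuotient permutation st_equiv st_class :=
  EqQuotient.on st_class.
HB.instance Definition _ := Choice.on st_class.

Definition class_of_perm (pi : permutation) : st_class := \pi_st_class pi.

Lemma class_of_permP pi sigma :
  class_of_perm pi = class_of_perm sigma <->
  st pi = st sigma /\ size pi = size sigma.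
Proof.
split=> [/eqmodP/andP[/eqP-> /eqP->] // | [eq_st eq_sz]].
by apply/eqmodP; rewrite /= /st_equiv eq_st eq_sz !eqxx.
Qed.

Lemma class_of_permK (c : st_class) : class_of_perm (repr c) = c.
Proof. exact: reprK. Qed.

End StatClass.

Fact shift_subproof (m : nat) pi :
  uniq (map (addn m) pi) && all (ltn 0) (map (addn m) pi).
Proof.
rewrite (map_inj_uniq (@addnI m)) perm_uniq all_map /=.
by apply: sub_all (perm_gt0 pi) => x /= x_gt0; rewrite addn_gt0 x_gt0 orbT.
Qed.

Definition shift_perm (m : nat) pi := Permutation (shift_subproof m pi).

Lemma shift_perm_order m pi : same_order (shift_perm m pi) pi.
Proof.
split=> [|i j]; first by rewrite size_map.
by rewrite size_map => lt_i lt_j; rewrite !(nth_map 0%N) // ltn_add2l.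
Qed.

Lemma shift_perm_disjoint m pi (s : seq nat) :
  all (fun x => x <= m)%N s -> ~~ has [in s] (shift_perm m pi).
Proof.
move=> /allP s_le; apply/hasPn => _ /mapP[x x_pi ->].
apply: contraL (allP (perm_gt0 pi) x x_pi) => /s_le.
by rewrite -{2}[m]addn0 leq_add2l /= -leqNgt.
Qed.

Lemma class_shift_perm (T : eqType) (st : statistic T) m pi :
  class_of_perm st (shift_perm m pi) = class_of_perm st pi.
Proof.
have ord := shift_perm_order m pi.
by apply/class_of_permP; split; [exact: stat_order | case: ord].
Qed.

Definition seq_max (s : seq nat) : nat := \max_(x <- s) x.

Lemma seq_max_ge (s : seq nat) : all (fun x => x <= seq_max s)%N s.
Proof. by apply/allP => x xs; apply: leq_bigmax_seq. Qed.

Lemma class_disjoint (T : eqType) (st : statistic T) (c : st_class st)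
    (s : seq nat) :
  exists2 pi, class_of_perm st pi = c & ~~ has [in s] (perm_seq pi).
Proof.
exists (shift_perm (seq_max s) (repr c)).
  by rewrite class_shift_perm class_of_permK.
exact/shift_perm_disjoint/seq_max_ge.
Qed.

Section Linext.
Variables (F : comNzRingType) (K : choiceType) (V : lmodType F).
Implicit Types (f : K -> V) (a b : {malg F[K]}).

Definition linext f a : V := \sum_(k <- msupp a) a@_k *: f k.

Lemma linextEw f a (d : {fset K}) : fsubset (msupp a) d ->
  linext f a = \sum_(k <- d) a@_k *: f k.
Proof.
move=> sad; rewrite /linext (big_fset_incl _ sad) // => k _ k_a.
by rewrite mcoeff_outdom // scale0r.
Qed.

Fact linext_is_linear f : linear (linext f).
Proof.
move=> c a b; pose d := fsetU (msupp a) (msupp b).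
rewrite !(@linextEw f _ d) ?fsubsetUl ?fsubsetUr //.
  rewrite scaler_sumr -big_split; apply: eq_bigr => k _.
  by rewrite mcoeffD mcoeffZ scalerDl scalerA.
apply: fsubset_trans (msuppD_le _ _) _; apply: fsetSU; exact: msuppZ_le.
Qed.

HB.instance Definition _ f :=
  GRing.isLinear.Build F {malg F[K]} V *:%R (linext f) (linext_is_linear f).

Lemma eq_linext f g a : f =1 g -> linext f a = linext g a.
Proof. by move=> eq_fg; apply: eq_bigr => k _; rewrite eq_fg. Qed.

Lemma linextP c f g a :
  linext (fun k => c *: f k + g k) a = c *: linext f a + linext g a.
Proof.
rewrite /linext scaler_sumr -big_split; apply: eq_bigr => k _.
by rewrite scalerDr !scalerA [c * _]mulrC.
Qed.

Lemma linextU f k : linext f << k >> = f k.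
Proof. by rewrite (linextEw _ (msuppU_le)) big_seq_fset1 mcoeffUU scale1r. Qed.

Lemma malg_sumE a : a = \sum_(k <- msupp a) a@_k *: << k >>.
Proof.
rewrite {1}(monalgE a); apply: eq_bigr => k _; apply/malgP => k'.
by rewrite mcoeffZ !mcoeffU mulr_natr.
Qed.

Lemma malg_linear_ind (P : {malg F[K]} -> Prop) :
  P 0 -> (forall c a b, P a -> P b -> P (c *: a + b)) ->
  (forall k, P << k >>) -> forall a, P a.
Proof.
move=> P0 PD PU a; rewrite (malg_sumE a).
elim/big_ind: _ => // [x y Px Py | k _].
  by rewrite -[x]scale1r; apply: PD.
by rewrite -[_ *: _]addr0; apply: PD.
Qed.

End Linext.

Definition shuffle_algebra (T : eqType) (st : statistic T)
  (Hst : shuffle_compatible st) : Type := {malg rat[st_class st]}.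

Section ShuffleAlgebra.
Variables (T : eqType) (st : statistic T) (Hst : shuffle_compatible st).

Local Notation A := (shuffle_algebra Hst).

HB.instance Definition _ := GRing.Lmodule.on A.

Definition cls pi : A := << class_of_perm st pi >>.

Definition shuffle_sum pi sigma : A := \sum_(tau <- shuffles pi sigma) cls tau.

(* The second representative is shifted to make the two disjoint; see clsM for
   the independence of this choice. *)
Definition class_mul (c d : st_class st) : A :=
  let pi : permutation := repr c in
  shuffle_sum pi (shift_perm (seq_max pi) (repr d)).

Fact shuffle_mul_key : unit. Proof. exact: tt. Qed.

Definition shuffle_mul : A -> A -> A :=
  locked_with shuffle_mul_key
    (fun a b => linext (fun c => linext (class_mul c) b) a).

Lemma shuffle_mulE a b :
  shuffle_mul a b = linext (fun c => linext (class_mul c) b) a.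
Proof. by rewrite [shuffle_mul]unlock. Qed.

Lemma perm_eq_class (s s' : seq permutation) n :
    {in s, forall tau, size tau = n} -> {in s', forall tau, size tau = n} ->
    perm_eq (map st s) (map st s') ->
  perm_eq (map (class_of_perm st) s) (map (class_of_perm st) s').
Proof.
move=> sz_s sz_s' /permP eq_st; apply/allP => c _ /=; rewrite !count_map.
have cntE u : {in u, forall tau, size tau = n} ->
    count (preim (class_of_perm st) (pred1 c)) u =
    ((size (repr c) == n) * count (preim st (pred1 (st (repr c)))) u)%N.
  move=> sz_u; case: eqP => [sz_c | sz_c]; rewrite ?mul1n ?mul0n.
    apply: eq_in_count => tau /sz_u sz_tau /=; rewrite -[c in LHS]class_of_permK.
    apply/eqP/eqP => [/class_of_permP[] // | eq_tau].
    by apply/class_of_permP; rewrite sz_tau sz_c.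
  apply/eqP; rewrite -leqn0 leqNgt -has_count; apply/hasP => -[tau /sz_u sz_tau].
  rewrite /= -[c]class_of_permK => /eqP/class_of_permP[_ sz].
  by case: sz_c; rewrite -sz.
by rewrite !cntE // -!count_map eq_st.
Qed.

Lemma size_shuffles pi sigma :
  {in shuffles pi sigma, forall tau, size tau = (size pi + size sigma)%N}.
Proof.
by move=> tau; rewrite mem_shuffles_perm -size_cat => /and3P[/perm_size].
Qed.

Lemma shuffle_sum_class pi pi' sigma sigma' :
    disjointp pi sigma -> disjointp pi' sigma' ->
    class_of_perm st pi = class_of_perm st pi' ->
    class_of_perm st sigma = class_of_perm st sigma' ->
  shuffle_sum pi sigma = shuffle_sum pi' sigma'.
Proof.
move=> d d' /class_of_permP[st_pi sz_pi] /class_of_permP[st_sg sz_sg].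
rewrite /shuffle_sum /cls.
rewrite -!(big_map (class_of_perm st) xpredT (fun c => << c >> : A)).
apply/perm_big/perm_eq_class; first exact: size_shuffles.
  by rewrite sz_pi sz_sg; exact: size_shuffles.
exact: Hst.
Qed.

Lemma class_mulE pi sigma : disjointp pi sigma ->
  class_mul (class_of_perm st pi) (class_of_perm st sigma) =
  shuffle_sum pi sigma.
Proof.
move=> d; apply: shuffle_sum_class => //.
- by rewrite disjointpC; apply/shift_perm_disjoint/seq_max_ge.
- exact: class_of_permK.
- by rewrite class_shift_perm class_of_permK.
Qed.

Lemma shuffle_mulU (c d : st_class st) :
  shuffle_mul << c >> << d >> = class_mul c d.
Proof. by rewrite shuffle_mulE !linextU. Qed.

Lemma shuffle_mul_cls pi sigma : disjointp pi sigma ->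
  shuffle_mul (cls pi) (cls sigma) = shuffle_sum pi sigma.
Proof. by move=> d; rewrite shuffle_mulU class_mulE. Qed.

Fact shuffle_mulPl (b : A) : linear (shuffle_mul^~ b).
Proof. by move=> k a1 a2; rewrite !shuffle_mulE; apply: linext_is_linear. Qed.

Fact shuffle_mulPr (a : A) : linear (shuffle_mul a).
Proof.
move=> k b1 b2; rewrite (shuffle_mulE a (k *: b1 + b2)).
rewrite (shuffle_mulE a b1) (shuffle_mulE a b2).
apply: etrans (linextP k (fun c => linext (class_mul c) b1) _ a).
apply: eq_linext => c; exact: linext_is_linear.
Qed.

HB.instance Definition _ a :=
  GRing.isLinear.Build rat A A *:%R (shuffle_mul a) (shuffle_mulPr a).

Lemma shuffle_mul0l b : shuffle_mul 0 b = 0.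
Proof. by rewrite shuffle_mulE; exact: (linear0 (linext _)). Qed.

Lemma shuffle_mul0r a : shuffle_mul a 0 = 0.
Proof. exact: (linear0 (shuffle_mul a)). Qed.

Lemma shuffle_mul_suml (I : Type) (r : seq I) (G : I -> A) b :
  shuffle_mul (\sum_(i <- r) G i) b = \sum_(i <- r) shuffle_mul (G i) b.
Proof.
rewrite shuffle_mulE; apply: etrans (linear_sum (linext _) r _ G) _.
by apply: eq_bigr => i _; rewrite shuffle_mulE.
Qed.

Lemma shuffle_algebra_ind (P : A -> Prop) :
  P 0 -> (forall c a b, P a -> P b -> P (c *: a + b)) ->
  (forall c : st_class st, P << c >>) -> forall a, P a.
Proof. exact: malg_linear_ind. Qed.

Fact shuffle_mulC : commutative shuffle_mul.
Proof.
move=> a b; elim/shuffle_algebra_ind: a => [|k a1 a2 IH1 IH2|c].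
- by rewrite shuffle_mul0l shuffle_mul0r.
- by rewrite shuffle_mulPl shuffle_mulPr IH1 IH2.
elim/shuffle_algebra_ind: b => [|k b1 b2 IH1 IH2|d].
- by rewrite shuffle_mul0l shuffle_mul0r.
- by rewrite shuffle_mulPl shuffle_mulPr IH1 IH2.
have [sigma <- _] := class_disjoint d [::].
have [pi <- dps] := class_disjoint c sigma.
have dsp : disjointp sigma pi by rewrite disjointpC.
rewrite -!/(cls _) !shuffle_mul_cls //; apply/perm_big/uniq_perm.
- exact: shuffles_uniq.
- exact: shuffles_uniq.
move=> tau; rewrite !mem_shuffles_perm [subseq pi tau && _]andbC.
by rewrite (permPr (permEl (perm_catC _ _))).
Qed.

Definition empty_perm := @Permutation [::] isT.

Fact shuffle_mul1 : left_id (cls empty_perm) shuffle_mul.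
Proof.
move=> a; elim/shuffle_algebra_ind: a => [|k a1 a2 IH1 IH2|c].
- exact: shuffle_mul0r.
- by rewrite shuffle_mulPr IH1 IH2.
rewrite -[c]class_of_permK -/(cls _); set pi : permutation := repr c.
rewrite shuffle_mul_cls // /shuffle_sum.
transitivity (\sum_(tau <- [:: pi]) cls tau); last by rewrite big_seq1.
apply/perm_big/uniq_perm => //.
  exact: shuffles_uniq.
move=> tau; rewrite mem_shuffles // inE add0n sub0seq /=.
apply/andP/eqP => [[/eqP sz sub] | -> //].
by apply/esym/val_inj/eqP; rewrite -(size_subseq_leqif sub) sz.
Qed.

Definition shuffles3 pi sigma rho : seq permutation :=
  [seq tau : permutation <- pmap insub (permutations (pi ++ sigma ++ rho))
     | [&& subseq pi tau, subseq sigma tau & subseq rho tau]].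

Lemma mem_shuffles3 pi sigma rho tau : tau \in shuffles3 pi sigma rho =
  [&& perm_eq tau (pi ++ sigma ++ rho), subseq pi tau, subseq sigma tau
    & subseq rho tau].
Proof.
by rewrite mem_filter mem_pmap_sub mem_permutations andbC.
Qed.

Lemma shuffles3_uniq pi sigma rho : uniq (shuffles3 pi sigma rho).
Proof.
by rewrite filter_uniq // (pmap_uniq (insubK _)) // permutations_uniq.
Qed.

(* tau is recovered from a shuffle of tau and rho by erasing the letters not
   in tau. *)
Lemma filter_shuffle (tau : permutation) (s u : seq nat) :
  uniq u -> perm_eq tau s -> subseq tau u -> [seq x <- u | x \in s] = tau.
Proof.
move=> Uu /perm_mem mem_tau /(subseq_uniqP Uu) ->.
by apply: eq_filter => x; rewrite mem_tau.
Qed.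

Fact filter_perm_subproof (s : seq nat) pi :
  uniq [seq x <- pi | x \in s] && all (ltn 0) [seq x <- pi | x \in s].
Proof.
rewrite filter_uniq ?perm_uniq //=; apply/allP => x.
by rewrite mem_filter => /andP[_ /(allP (perm_gt0 pi))].
Qed.

Definition filter_perm s pi := Permutation (filter_perm_subproof s pi).

Lemma shuffle_sum3 pi sigma rho :
    disjointp pi rho -> disjointp sigma rho ->
  \sum_(tau <- shuffles pi sigma) shuffle_sum tau rho =
  \sum_(u <- shuffles3 pi sigma rho) cls u.
Proof.
move=> dpr dsr; pose e u := filter_perm (pi ++ sigma) u.
transitivity (\sum_(tau <- shuffles pi sigma)
                \sum_(u <- shuffles3 pi sigma rho | e u == tau) cls u).
  apply: eq_big_seq => tau; rewrite mem_shuffles_perm => /and3P[ptau st1 st2].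
  rewrite /shuffle_sum -[RHS]big_filter; apply/perm_big/uniq_perm.
  - exact: shuffles_uniq.
  - by rewrite filter_uniq // shuffles3_uniq.
  move=> u; rewrite [RHS]mem_filter mem_shuffles_perm mem_shuffles3 catA.
  have -> : perm_eq u (tau ++ rho) = perm_eq u ((pi ++ sigma) ++ rho).
    by apply: permPr; rewrite perm_cat2r.
  case: (perm_eq u _) => //=; last by rewrite andbF.
  apply/andP/and4P => [[tu ru] | [/eqP <- _ _ ru]].
    split=> //; try exact: subseq_trans tu.
    by apply/eqP/val_inj; apply: filter_shuffle; rewrite ?perm_uniq.
  by split=> //; apply: filter_subseq.
rewrite (exchange_big_dep xpredT) //=; apply: eq_big_seq => u.
rewrite mem_shuffles3 => /and4P[pu su1 su2 _].
rewrite -big_filter.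
transitivity (\sum_(tau <- [:: e u]) cls u); last by rewrite big_seq1.
apply/perm_big/uniq_perm => //; first by rewrite filter_uniq // shuffles_uniq.
move=> tau; rewrite [LHS]mem_filter inE eq_sym; case: eqP => //= ->.
rewrite mem_shuffles_perm !subseq_filter su1 su2 /= !andbT.
apply/and3P; split; try by apply/allP => x; rewrite mem_cat => ->; rewrite ?orbT.
apply: perm_trans (perm_filter _ pu) _.
rewrite catA filter_cat (_ : [seq x <- rho | x \in pi ++ sigma] = [::]).
  by rewrite cats0 (@eq_in_filter _ _ predT) ?filter_predT // => x.
apply/eqP; rewrite -[_ == _]negbK -has_filter; apply/hasP => -[x x_rho].
rewrite mem_cat => /orP[] x_in; [move: dpr | move: dsr];
  by move=> /hasPn/(_ _ x_in)/negP; apply.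
Qed.

Fact shuffle_mulA : associative shuffle_mul.
Proof.
move=> a b c; elim/shuffle_algebra_ind: a => [|k a1 a2 IH1 IH2|x].
- by rewrite !shuffle_mul0l.
- by rewrite !shuffle_mulPl IH1 IH2.
elim/shuffle_algebra_ind: b => [|k b1 b2 IH1 IH2|y].
- by rewrite shuffle_mul0r !shuffle_mul0l shuffle_mul0r.
- by rewrite !(shuffle_mulPl, shuffle_mulPr) IH1 IH2.
elim/shuffle_algebra_ind: c => [|k c1 c2 IH1 IH2|z].
- by rewrite !shuffle_mul0r.
- by rewrite !shuffle_mulPr IH1 IH2.
have [pi <- _] := class_disjoint x [::].
have [sigma <- dsp] := class_disjoint y pi.
have [rho <-] := class_disjoint z (pi ++ sigma).
rewrite -!/(cls _) has_sym has_cat negb_or => /andP[dpr dsr].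
have dps : disjointp pi sigma by rewrite disjointpC.
rewrite !shuffle_mul_cls // ![shuffle_sum _ _ in LHS]/shuffle_sum.
rewrite [shuffle_sum pi _]/shuffle_sum.
rewrite (linear_sum (shuffle_mul _)) shuffle_mul_suml /=.
have disj (tau s1 s2 s3 : permutation) : tau \in shuffles s1 s2 ->
    disjointp s1 s3 -> disjointp s2 s3 -> disjointp tau s3.
  rewrite mem_shuffles_perm => /and3P[/perm_mem mem_tau _ _].
  by rewrite /disjointp (eq_has_r mem_tau) => d1 d2; rewrite has_cat negb_or d1.
transitivity (\sum_(u <- shuffles3 sigma rho pi) cls u).
  rewrite -shuffle_sum3 1?disjointpC //; apply: eq_big_seq => tau tau_in.
  have dtp : disjointp tau pi by apply: disj tau_in _ _; rewrite // disjointpC.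
  by rewrite shuffle_mulC shuffle_mul_cls.
transitivity (\sum_(u <- shuffles3 pi sigma rho) cls u).
  apply/perm_big/uniq_perm; rewrite ?shuffles3_uniq // => tau.
  rewrite !mem_shuffles3 catA (permPr (permEl (perm_catC _ _))).
  by congr (_ && _); do 3 case: subseq.
rewrite -shuffle_sum3 //; apply: eq_big_seq => tau tau_in.
by rewrite shuffle_mul_cls //; apply: disj tau_in _ _.
Qed.

Fact shuffle_mulDl : left_distributive shuffle_mul +%R.
Proof. by move=> a b c; by rewrite !shuffle_mulE; exact: (linearD (linext _)). Qed.

Fact shuffle_one_neq0 : cls empty_perm != 0.
Proof. by rewrite monalgU_eq0 oner_eq0. Qed.

HB.instance Definition _ := GRing.Zmodule_isComNzRing.Build A
  shuffle_mulA shuffle_mulC shuffle_mul1 shuffle_mulDl shuffle_one_neq0.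

Fact shuffle_scaleAl (k : rat) (a b : A) : k *: (a * b) = k *: a * b.
Proof. rewrite -![LHS]/(k *: shuffle_mul a b) -[RHS]/(shuffle_mul (k *: a) b).
rewrite !shuffle_mulE; apply/esym; exact: (linearZ_LR (linext _)). Qed.

HB.instance Definition _ :=
  GRing.Lmodule_isLalgebra.Build rat A shuffle_scaleAl.
HB.instance Definition _ := GRing.Lalgebra_isComAlgebra.Build rat A.

Lemma clsM pi sigma : disjointp pi sigma ->
  cls pi * cls sigma = \sum_(tau <- shuffles pi sigma) cls tau.
Proof. exact: shuffle_mul_cls. Qed.

Lemma cls1 : cls empty_perm = 1.
Proof. by []. Qed.

Definition shuffle_component (n : nat) : set A :=
  lspan [set cls pi | pi in [set pi : permutation | size pi = n]].

End ShuffleAlgebra.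

Arguments shuffle_component {T st} Hst n.

(* Main.v *)
(* Removing the last letter of a shuffle of two words of lengths m and n shows,
   by induction, that the shuffles ending with the last letter a of the first
   word have generating function
     q^(maj pi + maj sigma) q^(n [b > a]) [m+n-1]! / ([m-1]! [n]!),
   where b is the last letter of the second word. Adding the symmetric formula
   and using [m+n] = [m] + q^m [n] gives the q-binomial formula for the sum of
   q^maj over all shuffles. It implies that maj is shuffle-compatible and that
   the map of the theorem is multiplicative. That map is injective because the
   images of distinct classes have distinct pairs of exponents (n, j), and it
   is onto because a final letter can be added so as to create a descent or not,
   so that maj takes all values from 0 to 'C(n, 2). *)

Require Import Defs.
From mathcomp Require Import all_boot all_order all_algebra.
From mathcomp Require Import boolp classical_sets.
From HB Require Import structures.
From mathcomp Require Import monalg.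
From mathcomp Require Import zify ring.

Set Implicit Arguments.
Unset Strict Implicit.
Unset Printing Implicit Defensive.

Import GRing.Theory.
Local Open Scope ring_scope.
Local Open Scope classical_set_scope.

(** * Interleavings of two words *)

Section Interleave.
Variable T : eqType.
Implicit Types s t u : seq T.

(** Shuffles listed by recursion on their first letter; the inner [fix] is there because each branch
    shortens only one of the two words. *)
Fixpoint interleave s : seq T -> seq (seq T) :=
  if s is a :: s' then
    fix interleave_s t := if t is b :: t' then
      map (cons a) (interleave s' t) ++ map (cons b) (interleave_s t')
    else [:: s]
  else fun t => [:: t].

Lemma interleave0s t : interleave [::] t = [:: t].
Proof. by []. Qed.

Lemma interleaves0 s : interleave s [::] = [:: s].
Proof. by case: s. Qed.

Lemma interleave_cons a s b t : interleave (a :: s) (b :: t) =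
  map (cons a) (interleave s (b :: t)) ++ map (cons b) (interleave (a :: s) t).
Proof. by []. Qed.

Lemma interleaveC s t : perm_eq (interleave s t) (interleave t s).
Proof.
elim: s t => [|a s IHs] t; first by rewrite interleaves0.
elim: t => [|b t IHt] //; rewrite !interleave_cons perm_catC.
by apply: perm_cat; apply: perm_map.
Qed.

Lemma size_interleave s t u :
  u \in interleave s t -> size u = (size s + size t)%N.
Proof.
elim: s t u => [|a s IHs] t u; first by rewrite inE => /eqP->.
elim: t u => [|b t IHt] u; first by rewrite inE addn0 => /eqP->.
rewrite interleave_cons mem_cat => /orP[] /mapP[v].
  by move=> /IHs sz -> /=; rewrite sz.
by move=> /IHt sz -> /=; rewrite sz addnS.
Qed.

Lemma subseq_interleavel s t u : u \in interleave s t -> subseq s u.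
Proof.
elim: s t u => [|a s IHs] t u; first by rewrite sub0seq.
elim: t u => [|b t IHt] u; first by rewrite inE => /eqP->.
rewrite interleave_cons mem_cat => /orP[] /mapP[v].
  by move=> /IHs sv ->; rewrite /= eqxx.
by move=> /IHt sv ->; apply: subseq_trans sv _; apply: subseq_cons.
Qed.

Lemma subseq_interleaver s t u : u \in interleave s t -> subseq t u.
Proof. by rewrite (perm_mem (interleaveC s t)); apply: subseq_interleavel. Qed.

Lemma interleave_uniq s t : ~~ has [in t] s -> uniq (interleave s t).
Proof.
elim: s t => [|a s IHs] // t; elim: t => [|b t IHt] // dst.
rewrite interleave_cons cat_uniq !map_inj_uniq; try by move=> ? ? [].
rewrite IHs; last by apply: contra dst => /= ->; rewrite orbT.
rewrite IHt ?andbT; last first.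
  by apply: contra dst; apply: sub_has => x xt; rewrite inE [x \in t]xt orbT.
apply/hasPn => _ /mapP[v _ ->]; apply/mapP => -[w _ [eq_ba _]].
by move: dst; rewrite /= eq_ba mem_head.
Qed.

(** The first letter of [u] is the head of [s] or of [t]: otherwise both words are subsequences of
    the tail of [u], where this letter does not recur. *)
Lemma mem_interleave s t u : uniq u -> perm_eq u (s ++ t) ->
  subseq s u -> subseq t u -> u \in interleave s t.
Proof.
elim: u s t => [|x u IHu] s t Uu.
  by case: s => [|a s] //; case: t => [|b t] // /perm_size.
case: s => [|a s] pu.
  rewrite inE => _ st; apply/eqP/esym/eqP.
  by rewrite -(size_subseq_leqif st) (perm_size pu).
case: t pu => [|b t] pu.
  rewrite inE => st _; apply/eqP/esym/eqP.
  by rewrite -(size_subseq_leqif st) (perm_size pu) cats0.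
have Ust : uniq ((a :: s) ++ b :: t) by rewrite -(perm_uniq pu).
move: Uu; rewrite cons_uniq => /andP[xNu Uu].
have neq_ab : b != a.
  move: Ust; rewrite cat_uniq => /and3P[_ + _] => /hasPn dst.
  by have /= := dst b (mem_head _ _); rewrite inE => /norP[].
rewrite interleave_cons mem_cat.
have [eq_ax | nax] := eqVneq x a.
  subst x; rewrite /= eqxx (negPf neq_ab) => su tu.
  apply/orP; left; apply: map_f; refine (IHu _ _ Uu _ su tu).
  by rewrite -(perm_cons a).
have [eq_bx | nbx] := eqVneq x b.
  subst x; rewrite /= eqxx eq_sym (negPf neq_ab) => su tu.
  apply/orP; right; apply: map_f; refine (IHu _ _ Uu _ su tu).
  by rewrite -(perm_cons b) (permPl pu) -[b :: t]cat1s perm_catCA.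
rewrite /= !(eq_sym _ x) (negPf nax) (negPf nbx).
move=> /mem_subseq su /mem_subseq tu.
have := perm_mem pu x; rewrite mem_head mem_cat => /esym/orP[/su | /tu].
  by rewrite (negPf xNu).
by rewrite (negPf xNu).
Qed.

End Interleave.

(** * The reversed major index and its values *)

(* The major index of the reversal of [w]. *)
Fixpoint rmaj (w : seq nat) : nat :=
  if w is x :: w' then
    (rmaj w' + (if w' is y :: _ then (x < y) * size w' else 0))%N
  else 0%N.

Lemma rmaj_cons x w :
  rmaj (x :: w) = (rmaj w + (if w is y :: _ then (x < y) * size w else 0))%N.
Proof. by []. Qed.

(** The last letter of [pi] becomes the head of the reversal; a descent into it weighs the number of
    letters before it. *)
Lemma maj_rev (pi : permutation) : maj pi = rmaj (rev pi).
Proof.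
rewrite /= /maj_fun; elim/last_ind: (perm_seq pi) => [|w x IHw].
  by rewrite big_geq.
rewrite rev_rcons rmaj_cons -{}IHw size_rcons.
case/lastP: w => [|w y]; first by rewrite !big_geq.
rewrite rev_rcons size_rcons big_mkcond big_nat_recr //= -big_mkcond /=.
congr (_ + _)%N.
  rewrite big_nat_cond [RHS]big_nat_cond; apply: eq_bigl => k.
  case: (ltnP k (size w).+1); rewrite ?andbF // => lt_k.
  rewrite ![nth _ (rcons (rcons _ _) _) _]nth_rcons size_rcons lt_k.
  by rewrite (leq_ltn_trans (leq_pred k) lt_k).
rewrite !nth_rcons size_rcons ltnn eqxx ltnSn size_rev ltnn eqxx.
by case: ltnP; rewrite ?mul1n ?mul0n.
Qed.

Lemma rmaj_map_succ w : rmaj (map succn w) = rmaj w.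
Proof.
by elim: w => // x [|y w] // IHw; rewrite map_cons rmaj_cons IHw size_map.
Qed.

Lemma rmaj_le w : (rmaj w <= 'C(size w, 2))%N.
Proof.
elim: w => // x w IHw; rewrite rmaj_cons /= binS bin1 leq_add //.
by case: w {IHw} => // y w; case: (x < y)%N; rewrite ?mul1n.
Qed.

Lemma rmaj_onto n j : (j <= 'C(n, 2))%N ->
  exists w : seq nat,
    [/\ uniq w, all (ltn 0) w, size w = n & rmaj w = j].
Proof.
elim: n j => [|n IHn] j.
  by rewrite leqn0 => /eqP->; exists [::].
rewrite binS bin1 => le_j.
have [/IHn[w [Uw w_gt0 sz_w <-]] | lt_j] := leqP j 'C(n, 2).
  have w_lt x : x \in w -> (x < (seq_max w).+1)%N.
    by move=> xw; rewrite ltnS; have /allP := seq_max_ge w; apply.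
  (* A new maximum in front leaves [rmaj] unchanged. *)
  exists ((seq_max w).+1 :: w); split=> //=.
  - by rewrite Uw andbT; apply/negP => /w_lt; rewrite ltnn.
  - by rewrite sz_w.
  - case: w w_lt {Uw w_gt0 sz_w} => // y w w_lt; rewrite ltnNge ltnW ?addn0 //.
    by apply: w_lt; rewrite mem_head.
have n_gt0 : (0 < n)%N by case: n le_j lt_j {IHn} => // ; lia.
(* Together with [lt_j] this gives [n <= j], so [j - n] below is not truncated. *)
have le_nC : (n.-1 <= 'C(n, 2))%N.
  by case: n n_gt0 {IHn lt_j le_j} => // n _; rewrite binS bin1 leq_addl.
have [|w [Uw w_gt0 sz_w rmaj_w]] := IHn (j - n)%N; first by lia.
(* After the shift, 1 is a new minimum; in front it adds [n] to [rmaj]. *)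
exists (1%N :: map succn w); split=> /=.
- rewrite map_inj_uniq ?Uw ?andbT; last exact: succn_inj.
  by apply/mapP => -[x /(allP w_gt0) /= x_gt0 [x0]]; rewrite -x0 in x_gt0.
- by rewrite all_map; apply/allP.
- by rewrite size_map sz_w.
- rewrite rmaj_map_succ rmaj_w; case: w w_gt0 sz_w {Uw rmaj_w} => [|y w] /=.
    by move=> _ n0; rewrite -n0 in n_gt0.
  by move=> /andP[y_gt0 _] sz_w; rewrite ltnS y_gt0 mul1n size_map sz_w; lia.
Qed.

(** * The q-binomial formula for interleavings *)

Section QIdentity.
Variables (R : comNzRingType) (q : R).

(** The q-integer, in an arbitrary commutative ring; the identities below are therefore stated
    without division. *)
Definition qnat (n : nat) : R := \sum_(0 <= k < n) q ^+ k.

Definition qfactorial (n : nat) : R := \prod_(1 <= i < n.+1) qnat i.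

Lemma qnatD m n : qnat (m + n) = qnat m + q ^+ m * qnat n.
Proof.
rewrite /qnat (@big_cat_nat _ _ _ m) //= ?leq_addr //; congr (_ + _).
rewrite -{1}[m]add0n big_addn addKn mulr_sumr.
by apply: eq_bigr => k _; rewrite exprD mulrC.
Qed.

Lemma qfactorial0 : qfactorial 0 = 1.
Proof. by rewrite /qfactorial big_geq. Qed.

Lemma qfactorialS n : qfactorial n.+1 = qfactorial n * qnat n.+1.
Proof. by rewrite /qfactorial big_nat_recr. Qed.

(* Shuffles of the reversed words [a :: s] and [t] whose first letter is [a],
   that is, shuffles of the original words which end with the last letter of
   the first one. *)
Lemma sum_interleave_cons (a : nat) (s t : seq nat) : ~~ has [in t] (a :: s) ->
  (\sum_(u <- interleave s t) q ^+ rmaj (a :: u))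
    * (qfactorial (size s).+1 * qfactorial (size t)) =
  q ^+ (rmaj (a :: s) + rmaj t + (a < head 0 t) * size t)
    * (qnat (size s).+1 * qfactorial (size s + size t)).
Proof.
have [n] := ubnP (size s + size t).
elim: n a s t => // n IHn a s t; rewrite ltnS => le_n dst.
case: s le_n dst => [|a' s] le_n dst.
  rewrite interleave0s big_seq1 qfactorialS qfactorial0 add0n /= !add0n.
  by case: t {le_n dst} => [|b t] /=; rewrite ?addn0; ring.
(* For empty [t], [head 0 t] takes its default value, made harmless by the factor [size t]. *)
case: t le_n dst => [|b t] le_n dst.
  rewrite interleaves0 big_seq1 qfactorial0 /= muln0 !addn0 qfactorialS; ring.
(* If [a < c], putting [a] in front adds the length of [c :: u], which is the same for all
   interleavings [u]. *)
have sum_cons (c : nat) (w w' : seq nat) :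
    \sum_(u <- interleave w w') q ^+ rmaj [:: a, c & u] =
    q ^+ ((a < c) * (size w + size w').+1)
      * \sum_(u <- interleave w w') q ^+ rmaj (c :: u).
  rewrite mulr_sumr; apply: eq_big_seq => u /size_interleave sz_u.
  by rewrite -exprD rmaj_cons /= sz_u addnC.
have [b_a b_a' dst1 dst2] : [/\ b != a, b != a',
    ~~ has [in b :: t] (a' :: s) & ~~ has [in a' :: s] (b :: t)].
  move: (dst); rewrite [has _ (a :: _)]/= negb_or => /andP[aNt dst'].
  split=> //; last by rewrite has_sym.
    by apply: contraNneq aNt => ->; rewrite mem_head.
  by apply: contraNneq dst' => ->; rewrite /= mem_head.
rewrite interleave_cons big_cat !big_map !sum_cons [size (a' :: s)]/=.
(* The words are swapped to match the induction hypothesis for [b]. *)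
rewrite (perm_big _ (interleaveC (a' :: s) t)) /=.
have IH1 := IHn a' s (b :: t) le_n dst1.
have lt_n : (size t + size (a' :: s) < n)%N by move: le_n => /=; lia.
have IH2 := IHn b t (a' :: s) lt_n dst2.
move: IH1 IH2 => /=; set m := (size s).+1; set l := (size t).+1.
set S1 := \sum_(_ <- _) _; set S2 := \sum_(_ <- _) _.
rewrite -/(rmaj (a' :: s)) -/(rmaj (b :: t)) => IH1 IH2.
set i := rmaj (a' :: s) in IH1 IH2 *; set j := rmaj (b :: t) in IH1 IH2 *.
have szE : (size t + m = size s + l)%N by rewrite /m /l; lia.
rewrite szE in IH2; set k := (size s + l)%N in IH1 IH2 *.
have kE : (m + l = k.+1)%N by rewrite /k /m addSn.
rewrite -/k (qfactorialS m) kE (qfactorialS k) -kE addnS.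
(* What remains once the induction hypotheses are inserted. Each consistent order of [a], [a'] and
   [b] reduces it to one of the two splittings of [qnat (m + l)]. *)
have key : q ^+ ((a < a') * (m + l) + (a' < b) * l) * qnat m
    + q ^+ ((a < b) * (m + l) + (b < a') * m) * qnat l
    = q ^+ ((a < a') * m + (a < b) * l) * qnat (m + l).
  have D1 := qnatD m l; have D2 := qnatD l m; rewrite addnC in D2.
  case: (ltngtP a' b) b_a' => // lt1 _; case: (ltngtP a b) b_a => // lt2 _;
  case: (ltnP a a') => lt3; try lia;
  rewrite ?(mul1n, mul0n, add0n, addn0) ?exprD ?expr0;
  by [rewrite D1; ring | rewrite D2; ring].
transitivity (qnat m.+1 * qfactorial k * q ^+ (i + j) *
  (q ^+ ((a < a') * (m + l) + (a' < b) * l) * qnat m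
    + q ^+ ((a < b) * (m + l) + (b < a') * m) * qnat l)).
  transitivity (qnat m.+1 *
    (q ^+ ((a < a') * (m + l)) * (S1 * (qfactorial m * qfactorial l))
     + q ^+ ((a < b) * (m + l)) * (S2 * (qfactorial l * qfactorial m)))).
    by rewrite addnS; ring.
  by rewrite IH1 IH2 !exprD; ring.
by rewrite key -addnS -/l !exprD; ring.
Qed.

(** For nonempty words of lengths m and l, [sum_interleave_cons] and its mirror image leave [q^l [m]
    + [l]] or [[m] + q^m [l]], according to which head is larger; both equal [[m + l]]. *)
Lemma sum_interleave (s t : seq nat) : ~~ has [in t] s ->
  (\sum_(u <- interleave s t) q ^+ rmaj u)
    * (qfactorial (size s) * qfactorial (size t)) =
  q ^+ (rmaj s + rmaj t) * qfactorial (size s + size t).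
Proof.
case: s => [|a s] dst.
  by rewrite interleave0s big_seq1 qfactorial0 /= !add0n; ring.
case: t dst => [|b t] dst.
  by rewrite interleaves0 big_seq1 qfactorial0 /= !addn0; ring.
have b_a : b != a.
  by apply: contraNneq dst => ->; rewrite /= mem_head.
have dts : ~~ has [in a :: s] (b :: t) by rewrite has_sym.
rewrite interleave_cons big_cat !big_map /=.
rewrite (perm_big _ (interleaveC (a :: s) t)) /= mulrDl.
rewrite (sum_interleave_cons dst) /=.
rewrite [X in _ + _ * X]mulrC (sum_interleave_cons dts) /=.
rewrite addSn qfactorialS addnS [(size t + _)%N]addnC addSn.
rewrite -/(rmaj (a :: s)) -/(rmaj (b :: t)).
set m := (size s).+1; set l := (size t).+1; set k := (size s + size t)%N.
have -> : k.+2 = (m + l)%N by rewrite /m /l /k addSn addnS.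
set i := rmaj (a :: s); set j := rmaj (b :: t).
have D1 := qnatD m l; have D2 := qnatD l m; rewrite addnC in D2.
case: (ltngtP a b) b_a => // lt_ab _; rewrite !(mul1n, mul0n, addn0) !exprD.
  by rewrite D2; ring.
by rewrite D1; ring.
Qed.

End QIdentity.

(** * Linear spans *)

Section Lspan.
Variables (F : nzRingType) (V : lmodType F).
Implicit Types (B S : set V) (u v : V).

Lemma sub_lspan B v : B v -> lspan B v.
Proof.
move=> Bv; exists 1%N, (fun=> 1), (fun=> v); split=> //.
by rewrite big_ord1 scale1r.
Qed.

Lemma lspan0 B : lspan B 0.
Proof.
exists 0%N, (fun=> 0), (fun=> 0); split=> [[] //|].
by rewrite big_ord0.
Qed.

Lemma lspan_linear B c u v : lspan B u -> lspan B v -> lspan B (c *: u + v).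
Proof.
move=> [m [k [b [Bb ->]]]] [n [l [d [Bd ->]]]].
exists (m + n)%N,
  (fun i => match split i with inl x => c * k x | inr x => l x end),
  (fun i => match split i with inl x => b x | inr x => d x end).
split=> [i|]; first by case: split.
rewrite big_split_ord scaler_sumr; congr (_ + _); apply: eq_bigr => i _.
  by rewrite (unsplitK (inl i)) scalerA.
by rewrite (unsplitK (inr i)).
Qed.

Lemma lspan_ind B S : S 0 -> (forall c u v, B u -> S v -> S (c *: u + v)) ->
  forall v, lspan B v -> S v.
Proof.
move=> S0 SD _ [n [c [b [Bb ->]]]].
by elim/big_rec: _ => // i v _ Sv; apply: SD.
Qed.

Lemma lspan_sub B S : S 0 -> (forall c u v, S u -> S v -> S (c *: u + v)) ->
  B `<=` S -> lspan B `<=` S.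
Proof. by move=> S0 SD BS; apply: lspan_ind => // c u v /BS; apply: SD. Qed.

End Lspan.

(** * Shuffle-compatibility of the major index *)

Local Notation q := (fps_var rat).

Lemma coef_fps_varX (R : comNzRingType) j k : (fps_var R ^+ j) k = (k == j)%:R.
Proof.
elim: j k => [|j IHj] k; first by rewrite expr0.
rewrite exprS /= big_ord_recl /= mul0r add0r.
case: k => [|k]; first by rewrite big_ord0.
rewrite big_ord_recl /= mul1r IHj subSS subn0 big1 ?addr0 // => i _.
by rewrite mul0r.
Qed.

(** Both lists are duplicate-free, so it suffices to compare their members. *)
Lemma perm_shuffles_interleave (pi sigma : permutation) : disjointp pi sigma ->
  perm_eq [seq rev (perm_seq tau) | tau <- shuffles pi sigma]
          (interleave (rev pi) (rev sigma)).
Proof.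
move=> dps; apply: uniq_perm => [||w].
- rewrite map_inj_uniq ?shuffles_uniq // => tau tau' /(can_inj revK).
  exact: val_inj.
- by apply: interleave_uniq; rewrite has_rev /= (eq_has (mem_rev _)).
have Ups : uniq (pi ++ sigma).
  by rewrite cat_uniq !Defs.perm_uniq has_sym andbT.
have rev_perm : perm_eq (rev pi ++ rev sigma) (pi ++ sigma).
  by apply: perm_cat; rewrite perm_rev.
apply/mapP/idP => [[tau + ->] | w_in].
  rewrite mem_shuffles_perm => /and3P[ptau st1 st2].
  apply: mem_interleave; rewrite ?subseq_rev ?rev_uniq ?Defs.perm_uniq //.
  by rewrite perm_rev (permPl ptau) perm_sym.
have sz_w := size_interleave w_in.
have := subseq_interleavel w_in; have := subseq_interleaver w_in.
rewrite -![subseq (rev _) w]subseq_rev !revK => sub2 sub1.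
have pw : perm_eq (rev w) (pi ++ sigma).
  apply: disjoint_cat_perm; rewrite ?Defs.perm_uniq //.
  by rewrite size_rev sz_w !size_rev.
have w_ok : uniq (rev w) && all (ltn 0) (rev w).
  rewrite (perm_uniq pw) Ups /= (perm_all _ pw) all_cat.
  by rewrite !perm_gt0.
exists (Permutation w_ok); last by rewrite revK.
by rewrite mem_shuffles_perm pw sub1 sub2.
Qed.

Lemma sum_shuffles_maj pi sigma : disjointp pi sigma ->
  (\sum_(tau <- shuffles pi sigma) q ^+ maj tau)
    * (qfact (size pi) * qfact (size sigma)) =
  q ^+ (maj pi + maj sigma) * qfact (size pi + size sigma).
Proof.
move=> dps; rewrite !maj_rev.
have drev : ~~ has [in rev sigma] (rev pi).
  by rewrite has_rev /= (eq_has (mem_rev _)).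
(* [qfact] is convertible to [qfactorial q]. *)
rewrite -(size_rev pi) -(size_rev sigma) -(sum_interleave q drev).
congr (_ * _); rewrite -(perm_big _ (perm_shuffles_interleave dps)) big_map.
by apply: eq_bigr => tau _; rewrite maj_rev.
Qed.

(** As [qfact] is invertible, [sum_shuffles_maj] determines the generating function of [maj] over
    the shuffles from the lengths and major indices; its coefficients are the multiplicities. *)
Lemma maj_shuffle_compatible : shuffle_compatible maj.
Proof.
move=> pi pi' sigma sigma' dps dps' eq_pi eq_sg sz_pi sz_sg.
have U n m : qfact n * qfact m \is a GRing.unit by rewrite unitrM !qfact_unit.
have eqS : \sum_(tau <- shuffles pi sigma) q ^+ maj tau =
           \sum_(tau <- shuffles pi' sigma') q ^+ maj tau.
  apply: (mulIr (U (size pi) (size sigma))).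
  rewrite sum_shuffles_maj // eq_pi eq_sg sz_pi sz_sg.
  by rewrite sum_shuffles_maj.
apply/allP => j _ /=; rewrite -(Num.Theory.eqr_nat rat).
have cntE p s : (count_mem j [seq maj tau | tau <- shuffles p s])%:R =
    (\sum_(tau <- shuffles p s) q ^+ maj tau) j.
  rewrite fps_sumE -sum1_count big_map natr_sum big_mkcond.
  apply: eq_bigr => tau _.
  by rewrite coef_fps_varX [j == _]eq_sym /=; case: eqP.
by rewrite !cntE eqS.
Qed.

(** * Products and coordinates of the [qterm]s *)

Lemma qtermM m j n k :
  qterm m j * qterm n k =
  (q ^+ (j + k) / (qfact m * qfact n))%:P * 'X^(m + n) :> qpsx.
Proof.
rewrite /qterm mulrACA -polyCM -exprD; congr (_%:P * _).
rewrite (invrM (qfact_unit _) (qfact_unit _)) exprD mulrACA.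
by rewrite [(qfact m)^-1 * _]mulrC.
Qed.

(** This is [sum_shuffles_maj] divided by all three q-factorials; the shuffles have equal lengths
    and so share a denominator. *)
Lemma qterm_sum_shuffles pi sigma : disjointp pi sigma ->
  qterm (size pi) (maj pi) * qterm (size sigma) (maj sigma) =
  \sum_(tau <- shuffles pi sigma) qterm (size tau) (maj tau).
Proof.
move=> dps; rewrite qtermM.
transitivity ((\sum_(tau <- shuffles pi sigma)
  q ^+ maj tau / qfact (size pi + size sigma))%:P
    * 'X^(size pi + size sigma) : qpsx); last first.
  rewrite rmorph_sum mulr_suml; apply: eq_big_seq => tau tau_in.
  by rewrite /qterm (size_shuffles tau_in).
congr (_%:P * _); rewrite -mulr_suml.
have U : qfact (size pi) * qfact (size sigma) \is a GRing.unit.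
  by rewrite unitrM !qfact_unit.
apply: (mulIr U); rewrite divrK // mulrAC sum_shuffles_maj //.
by rewrite mulrK ?qfact_unit.
Qed.

(* Reads off the coordinate of [qterm n j] in the family of all [qterm]s. *)
Definition qterm_coord (n j : nat) (p : qpsx) : rat :=
  (qfact n * (p : {poly fps rat})`_n) j.

Lemma qterm_coord_is_linear n j : linear_for *%R (qterm_coord n j).
Proof.
move=> c u v; rewrite /qterm_coord coefD coefZ mulrDr -scalerAl mul1r.
by rewrite -scalerAr.
Qed.

HB.instance Definition _ n j :=
  GRing.isLinear.Build rat qpsx rat *%R (qterm_coord n j)
    (qterm_coord_is_linear n j).

(** Multiplying by [qfact n] cancels the denominator and leaves a pure power of [q]. The coordinates
    are thus dual to the family of [qterm]s. *)
Lemma qterm_coord_qterm n j n' j' :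
  qterm_coord n j (qterm n' j') = ((n == n') && (j == j'))%:R.
Proof.
rewrite /qterm_coord /qterm coefCM coefXn; case: eqP => [<- | _].
  by rewrite mulr1n mulr1 mulrC divrK ?qfact_unit // coef_fps_varX.
by rewrite mulr0n !mulr0.
Qed.

Lemma maj_le pi : (maj pi <= 'C(size pi, 2))%N.
Proof. by rewrite maj_rev -size_rev rmaj_le. Qed.

Lemma maj_onto n j : (j <= 'C(n, 2))%N ->
  exists pi : permutation, size pi = n /\ maj pi = j.
Proof.
move=> /rmaj_onto[w [Uw w_gt0 sz_w rmaj_w]].
have w_ok : uniq (rev w) && all (ltn 0) (rev w) by rewrite rev_uniq Uw all_rev.
by exists (Permutation w_ok); rewrite maj_rev revK size_rev.
Qed.

(** * The isomorphism and the dimensions *)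

Section MajAlgebra.
Variable Hmaj : shuffle_compatible maj.
Local Notation A := (shuffle_algebra Hmaj).

(** Uses the chosen representative; by [maj_phi_cls] any other gives the same value. *)
Definition maj_qterm (c : st_class maj) : qpsx :=
  qterm (size (repr c)) (maj (repr c)).

Definition maj_phi : A -> qpsx := linext maj_qterm.

Fact maj_phi_is_linear : linear maj_phi.
Proof. exact: linext_is_linear. Qed.

HB.instance Definition _ :=
  GRing.isLinear.Build rat A qpsx *:%R maj_phi maj_phi_is_linear.

Lemma maj_phi_cls pi : maj_phi (cls Hmaj pi) = qterm (size pi) (maj pi).
Proof.
rewrite /maj_phi linextU /maj_qterm.
by have /class_of_permP[-> ->] := class_of_permK (class_of_perm maj pi).
Qed.

Fact maj_phi_monoid_morphism : monoid_morphism maj_phi.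
Proof.
split=> [|a b].
  rewrite -cls1 maj_phi_cls /qterm /= /maj_fun big_geq // expr0.
  by rewrite /qfact big_geq // divr1 expr0 mulr1.
elim/shuffle_algebra_ind: a => [|k a1 a2 IH1 IH2|c].
- by rewrite mul0r linear0 mul0r.
- by rewrite mulrDl -scalerAl !maj_phi_is_linear IH1 IH2 mulrDl -scalerAl.
elim/shuffle_algebra_ind: b => [|k b1 b2 IH1 IH2|d].
- by rewrite mulr0 linear0 mulr0.
- by rewrite mulrDr -scalerAr !maj_phi_is_linear IH1 IH2 mulrDr -scalerAr.
(* On basis classes, disjoint representatives make [clsM] applicable. *)
have [sigma <- _] := class_disjoint d [::].
have [pi <- dps] := class_disjoint c sigma.
rewrite -!/(cls Hmaj _) clsM // linear_sum !maj_phi_cls qterm_sum_shuffles //.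
by apply: eq_bigr => tau _; rewrite -maj_phi_cls.
Qed.

HB.instance Definition _ :=
  GRing.isMonoidMorphism.Build A qpsx maj_phi maj_phi_monoid_morphism.

(** A class is determined by its length and major index, so every coefficient of [a] can be read off
    its image; injectivity follows. *)
Lemma qterm_coord_phi (a : A) (c : st_class maj) :
  qterm_coord (size (repr c)) (maj (repr c)) (maj_phi a) = a@_c.
Proof.
elim/shuffle_algebra_ind: a => [|k a1 a2 IH1 IH2|d].
- by rewrite !linear0 mcoeff0.
- by rewrite maj_phi_is_linear qterm_coord_is_linear IH1 IH2 mcoeffD mcoeffZ.
rewrite /maj_phi linextU /maj_qterm qterm_coord_qterm mcoeffU.
congr (nat_of_bool _)%:R.
apply/andP/eqP => [[/eqP sz /eqP mj] | -> //].
by rewrite -[d]class_of_permK -[c]class_of_permK; apply/class_of_permP.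
Qed.

Lemma maj_phi_inj : injective maj_phi.
Proof.
move=> a b eq_ab; apply/malgP => c.
by rewrite -!qterm_coord_phi eq_ab.
Qed.

(** [maj_le] puts the image inside the span, and [maj_onto] makes every generator an image. *)
Lemma range_maj_phi : range maj_phi =
  lspan [set p | exists n j : nat, (j <= 'C(n, 2))%N /\ p = qterm n j].
Proof.
apply/seteqP; split=> [_ [a _ <-] | ].
  elim/shuffle_algebra_ind: a => [|k a1 a2 W1 W2|c].
  - by rewrite linear0; apply: lspan0.
  - by rewrite maj_phi_is_linear; apply: lspan_linear.
  rewrite -[c]class_of_permK -/(cls Hmaj _) maj_phi_cls; apply: sub_lspan.
  by exists (size (repr c)), (maj (repr c)); split; first exact: maj_le.
apply: lspan_sub => [|k _ _ [a _ <-] [b _ <-] | _ [n [j [+ ->]]]].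
3: move=> /maj_onto[pi [<- <-]].
- by exists 0; rewrite ?linear0.
- by exists (k *: a + b); rewrite ?maj_phi_is_linear.
- by exists (cls Hmaj pi); rewrite ?maj_phi_cls.
Qed.

Lemma shuffle_component_dim n :
  has_dim (shuffle_component Hmaj n) ('C(n, 2)).+1.
Proof.
(* One permutation for each value from 0 to ['C(n, 2)], whence the [.+1]. *)
have /choice[f fP] (i : 'I_('C(n, 2)).+1) :
    exists pi : permutation, size pi = n /\ maj pi = i.
  by apply: maj_onto; rewrite -ltnS.
exists (fun i => cls Hmaj (f i)); split=> [c c0 i | ].
  (* This coefficient isolates [c i], since different major indices give different classes. *)
  have /(congr1 (fun a : A => a@_(class_of_perm maj (f i)))) := c0.
  rewrite mcoeff0 raddf_sum (bigD1 i) //= mcoeffZ mcoeffUU mulr1.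
  rewrite big1 ?addr0 // => j /eqP neq_ji; rewrite mcoeffZ mcoeffU.
  case: eqP => [/class_of_permP[eq_maj _] | _]; last by rewrite mulr0.
  by case: neq_ji; apply: val_inj; rewrite /= -(fP i).2 -(fP j).2.
apply/seteqP; split; apply: lspan_sub; try exact: lspan0;
  try (by move=> *; apply: lspan_linear).
  move=> _ [i _ <-]; apply: sub_lspan; exists (f i) => //.
  exact: (fP i).1.
move=> _ [pi sz_pi <-]; apply: sub_lspan.
have lt_maj : (maj pi < ('C(n, 2)).+1)%N by rewrite ltnS -sz_pi maj_le.
exists (Ordinal lt_maj) => //; congr << _ >>.
by apply/class_of_permP; have [-> ->] := fP (Ordinal lt_maj).
Qed.

End MajAlgebra.

Theorem theorem3p1 :
  shuffle_compatible maj /\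
  forall Hmaj : shuffle_compatible maj,
    let W : set qpsx := lspan [set p | exists n j : nat,
                                 (j <= 'C(n, 2))%N /\ p = qterm n j] in
    [/\ GRing.subalg_closed [in W],
        exists phi : {lrmorphism shuffle_algebra Hmaj -> qpsx},
          [/\ forall pi : permutation,
                 phi (cls Hmaj pi) = qterm (size pi) (maj pi),
              injective phi
            & range phi = W]
      & forall n : nat, has_dim (shuffle_component Hmaj n) ('C(n, 2)).+1].
Proof.
split=> [|Hmaj W]; first exact: maj_shuffle_compatible.
have rangeE : range (@maj_phi Hmaj) = W := range_maj_phi Hmaj.
split.
(* The closure properties hold because [W] is the image of an algebra morphism. *)
- rewrite -rangeE; split.
  + by apply/mem_set; exists 1; rewrite ?rmorph1.
  + move=> k _ _ /set_mem[a _ <-] /set_mem[b _ <-]; apply/mem_set.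
    by exists (k *: a + b); rewrite ?maj_phi_is_linear.
  + move=> _ _ /set_mem[a _ <-] /set_mem[b _ <-]; apply/mem_set.
    by exists (a * b); rewrite ?rmorphM.
- exists (@maj_phi Hmaj : {lrmorphism shuffle_algebra Hmaj -> qpsx}).
  by split=> //; [exact: maj_phi_cls | exact: maj_phi_inj].
- exact: shuffle_component_dim.
Qed.
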